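(* Assume the reduced operator $\widehat A_h\in\mathbb{R}^{M_h\times n_h}$ has full column rank with $M_h\ge n_h$. For every $\ell_h\in\mathbb{R}^{N_h}$, $$\ell_h^\top(U_\theta-U_h^\star)=g_{\ell,h}^\top r_h .$$ Moreover, $$\sigma_{\ell,h}=\left(\widehat\ell_h^\top\widehat H_h^{-1}\widehat\ell_h\right)^{1/2}.$$ Consequently, $$|\ell_h^\top(U_\theta-U_h^\star)|\le\sigma_{\ell,h}\|r_h\|_{W_h}.$$
   Context: Let $U_{0,h}\in\mathbb{R}^{N_h}$ and let $Z_h\in\mathbb{R}^{N_h\times n_h}$ have full column rank. Let $A_h\in\mathbb{R}^{M_h\times N_h}$, $b_h\in\mathbb{R}^{M_h}$, $\widehat A_h:=A_hZ_h$, $\widehat b_h:=b_h-A_hU_{0,h}$. Let $W_h\in\mathbb{R}^{M_h\times M_h}$ be symmetric positive definite, $\|r\|_{W_h}:=(r^\top W_hr)^{1/2}$, $\|g\|_{W_h^{-1}}:=(g^\top W_h^{-1}g)^{1/2}$, $\widehat H_h:=\widehat A_h^\top W_h\widehat A_h$. The discrete target is the least-squares solution $y_h^\star:=\arg\min_{y\in\mathbb{R}^{n_h}}\frac12\|\widehat A_hy-\widehat b_h\|_{W_h}^2$, $U_h^\star:=U_{0,h}+Z_hy_h^\star$. $U_\theta=U_{0,h}+Z_hy_\theta$ (with $y_\theta\in\mathbb{R}^{n_h}$) is an arbitrary admissible vector with residual $r_h:=A_hU_\theta-b_h=\widehat A_hy_\theta-\widehat b_h$. For $\ell_h\in\mathbb{R}^{N_h}$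 put $\widehat\ell_h:=Z_h^\top\ell_h$, let $q_{\ell,h}$ solve $\widehat H_hq_{\ell,h}=\widehat\ell_h$, and define $g_{\ell,h}:=W_h\widehat A_hq_{\ell,h}\in\mathbb{R}^{M_h}$, $\sigma_{\ell,h}:=\|g_{\ell,h}\|_{W_h^{-1}}$. *)

(* Defs.v *)
From mathcomp Require Import all_boot all_order all_algebra.
From mathcomp Require Import reals.

Set Implicit Arguments.
Unset Strict Implicit.
Unset Printing Implicit Defensive.

Import Order.TTheory GRing.Theory Num.Theory.
Local Open Scope ring_scope.

Definition dotv (R : realType) (m : nat) (u v : 'cV[R]_m) : R :=
  (u^T *m v) 0 0.

Definition sym_posdef (R : realType) (m : nat) (W : 'M[R]_m) : Prop :=
  W^T = W /\ forall x : 'cV[R]_m, x != 0 -> 0 < dotv x (W *m x).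

Definition wnorm (R : realType) (m : nat) (W : 'M[R]_m) (x : 'cV[R]_m) : R :=
  Num.sqrt (dotv x (W *m x)).

(* [\rank] is the row rank; it equals the column rank. *)
Definition full_column_rank (R : realType) (m n : nat) (A : 'M[R]_(m, n)) :
    Prop :=
  \rank A = n.

Definition is_argmin (R : realType) (T : Type) (f : T -> R) (x : T) : Prop :=
  forall y : T, f x <= f y.

Definition reduced_op (R : realType) (M N n : nat)
    (A : 'M[R]_(M, N)) (Z : 'M[R]_(N, n)) : 'M[R]_(M, n) :=
  A *m Z.

Definition reduced_rhs (R : realType) (M N : nat)
    (A : 'M[R]_(M, N)) (b : 'cV[R]_M) (U0 : 'cV[R]_N) : 'cV[R]_M :=
  b - A *m U0.

Definition gram (R : realType) (M n : nat)
    (W : 'M[R]_M) (A : 'M[R]_(M, n)) : 'M[R]_n :=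
  A^T *m W *m A.

Definition lsq_objective (R : realType) (M n : nat)
    (W : 'M[R]_M) (A : 'M[R]_(M, n)) (b : 'cV[R]_M) (y : 'cV[R]_n) : R :=
  2^-1 * wnorm W (A *m y - b) ^+ 2.

(* Main.v *)
Require Import Defs.
From mathcomp Require Import all_boot all_order all_algebra.
From mathcomp Require Import reals.
From mathcomp Require Import ring lra.

Import Order.TTheory GRing.Theory Num.Theory.
Local Open Scope ring_scope.

(** At a minimiser the residual [rstar] is W-orthogonal to the range of
    [Ahat], because a nonnegative quadratic polynomial without constant term
    has no linear term.  The residual of [ytheta] differs from [rstar] by
    [Ahat (ytheta - ystar)], so pairing it with [g = W Ahat q] leaves
    [(Hhat q)^T (ytheta - ystar) = ell^T Z (ytheta - ystar)].  The bound is the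
    Cauchy-Schwarz inequality for the W-inner product of [Ahat q] and [r]. *)

Lemma dotvC (R : realType) m (u v : 'cV[R]_m) : dotv u v = dotv v u.
Proof.
by rewrite /dotv !mxE; apply: eq_bigr => i _; rewrite !mxE mulrC.
Qed.

Lemma dotvDr (R : realType) m (u v w : 'cV[R]_m) :
  dotv u (v + w) = dotv u v + dotv u w.
Proof. by rewrite /dotv mulmxDr mxE. Qed.

Lemma dotvZr (R : realType) m (u v : 'cV[R]_m) (a : R) :
  dotv u (a *: v) = a * dotv u v.
Proof. by rewrite /dotv -scalemxAr mxE. Qed.

Lemma dotv_mulmxr (R : realType) m n (A : 'M[R]_(m, n)) u v :
  dotv u (A *m v) = dotv (A^T *m u) v.
Proof. by rewrite /dotv trmx_mul trmxK mulmxA. Qed.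

(** Allowing [a = 0] spares later uses a case split on zero vectors. Cauchy-Schwarz takes general
    [c]; orthogonality takes [c = 0]. *)
Lemma quadratic_ge0_discr (R : realType) (a b c : R) :
  0 <= a -> (forall t, 0 <= c + 2 * t * b + t ^+ 2 * a) -> b ^+ 2 <= a * c.
Proof.
rewrite le_eqVlt => /predU1P[<- | a_gt0] pos.
  rewrite mul0r; have [-> | b_neq0] := eqVneq b 0; first by rewrite expr0n.
  (* With [a = 0] and [b] nonzero the polynomial is affine; this [t] gives it the value -1. *)
  have := pos (- (c + 1) / (2 * b)).
  have -> : 2 * (- (c + 1) / (2 * b)) * b = - (c + 1) by field.
  by rewrite mulr0; lra.
(* The vertex of the parabola. *)
have := pos (- b / a).
have -> : c + 2 * (- b / a) * b + (- b / a) ^+ 2 * a = (a * c - b ^+ 2) / a.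
  by field; rewrite gt_eqF.
by rewrite pmulr_lge0 ?invr_gt0// subr_ge0.
Qed.

Section PositiveDefinite.
Context (R : realType) (m : nat) (W : 'M[R]_m) (W_spd : sym_posdef W).
Implicit Types x y : 'cV[R]_m.

Lemma sym_posdef_ge0 x : 0 <= dotv x (W *m x).
Proof.
have [-> | /W_spd.2/ltW//] := eqVneq x 0.
by rewrite mulmx0 /dotv mulmx0 mxE.
Qed.

Lemma sym_posdef_dotvC x y : dotv x (W *m y) = dotv y (W *m x).
Proof. by rewrite dotv_mulmxr W_spd.1 dotvC. Qed.

Lemma sym_posdef_dotvD x y (t : R) :
  dotv (x + t *: y) (W *m (x + t *: y)) =
  dotv x (W *m x) + 2 * t * dotv y (W *m x) + t ^+ 2 * dotv y (W *m y).
Proof.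
rewrite mulmxDr -scalemxAr dotvDr dotvZr.
rewrite ![dotv (x + _) _]dotvC !dotvDr !dotvZr.
rewrite ![dotv (W *m _) _]dotvC (sym_posdef_dotvC x y); ring.
Qed.

Lemma sqr_wnorm x : wnorm W x ^+ 2 = dotv x (W *m x).
Proof. by rewrite sqr_sqrtr ?sym_posdef_ge0. Qed.

(** After squaring, this is the discriminant bound for the squared W-norm of [y + t *: x] as a
    polynomial in [t]. *)
Lemma wnorm_cauchy_schwarz x y :
  `|dotv x (W *m y)| <= wnorm W x * wnorm W y.
Proof.
rewrite -sqrtrM ?sym_posdef_ge0// -sqrtr_sqr ler_wsqrtr//.
apply: quadratic_ge0_discr; first exact: sym_posdef_ge0.
by move=> t; rewrite -sym_posdef_dotvD sym_posdef_ge0.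
Qed.

(** A nonzero row [v] with [v *m W = 0] would make the quadratic form vanish at [v^T]. *)
Lemma sym_posdef_unitmx : W \in unitmx.
Proof.
rewrite unitmxE unitfE; apply/negP => /det0P[v v_neq0 vW0].
have /W_spd.2 : v^T != 0 by rewrite trmx_eq0.
by rewrite /dotv trmxK mulmxA vW0 mul0mx mxE ltxx.
Qed.

End PositiveDefinite.

Lemma full_column_rank_inj {R : realType} {m n} {A : 'M[R]_(m, n)} {x} :
  full_column_rank A -> A *m x = 0 :> 'cV_m -> x = 0.
Proof.
move=> rkA Ax0; apply: trmx_inj; rewrite trmx0.
have AT_free : row_free A^T by rewrite /row_free mxrank_tr rkA.
by apply: (row_free_inj AT_free); rewrite -trmx_mul Ax0 trmx0 mul0mx.
Qed.

Lemma dotv_gram (R : realType) m n (W : 'M[R]_m) (A : 'M[R]_(m, n)) x y :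
  dotv x (gram W A *m y) = dotv (A *m x) (W *m (A *m y)).
Proof. by rewrite /gram -!mulmxA dotv_mulmxr trmxK. Qed.

(** The form at [x] is the W-form at [A *m x], which is nonzero because [A] is injective. *)
Lemma sym_posdef_gram {R : realType} {m n} {W : 'M[R]_m} {A : 'M[R]_(m, n)} :
  sym_posdef W -> full_column_rank A -> sym_posdef (gram W A).
Proof.
move=> W_spd rkA; split=> [|x x_neq0].
  by rewrite /gram !trmx_mul trmxK W_spd.1 mulmxA.
rewrite dotv_gram; apply: W_spd.2.
by apply: contraNneq x_neq0 => /(full_column_rank_inj rkA)->.
Qed.

Lemma lsq_argmin_orthogonal (R : realType) m n
    (W : 'M[R]_m) (A : 'M[R]_(m, n)) b y d :
  sym_posdef W -> is_argmin (lsq_objective W A b) y ->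
  dotv (A *m d) (W *m (A *m y - b)) = 0.
Proof.
move=> W_spd ymin; apply/eqP; rewrite -sqrf_eq0 eq_le sqr_ge0 andbT.
(* Writing 0 as [a * 0] exposes the discriminant bound with [c = 0]. *)
rewrite -[leRHS](mulr0 (dotv (A *m d) (W *m (A *m d)))).
apply: quadratic_ge0_discr => [|t]; first exact: sym_posdef_ge0.
(* Perturbing the minimiser along [d] changes the objective by half the required polynomial in
   [t]. *)
have := ymin (y + t *: d); rewrite /lsq_objective !sqr_wnorm//.
have -> : A *m (y + t *: d) - b = (A *m y - b) + t *: (A *m d).
  by rewrite mulmxDr -scalemxAr addrAC.
by rewrite sym_posdef_dotvD// ler_pM2l ?invr_gt0// => ?; lra.
Qed.

Theorem propositionB4 (R : realType) (N n M : nat)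
    (U0 : 'cV[R]_N) (Z : 'M[R]_(N, n)) (A : 'M[R]_(M, N)) (b : 'cV[R]_M)
    (W : 'M[R]_M)
    (Z_rank : full_column_rank Z)
    (W_spd : sym_posdef W)
    (Ahat_rank : full_column_rank (reduced_op A Z))
    (le_n_M : (n <= M)%N)
    (ystar : 'cV[R]_n)
    (ystar_argmin :
       is_argmin (lsq_objective W (reduced_op A Z) (reduced_rhs A b U0)) ystar)
    (ytheta : 'cV[R]_n)
    (ell : 'cV[R]_N)
    (q : 'cV[R]_n)
    (q_sol : gram W (reduced_op A Z) *m q = Z^T *m ell) :
  let Ustar := U0 + Z *m ystar in
  let Utheta := U0 + Z *m ytheta in
  let r := A *m Utheta - b in
  let ellhat := Z^T *m ell in
  let Hhat := gram W (reduced_op A Z) in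
  let g := W *m reduced_op A Z *m q in
  let sigma := wnorm (invmx W) g in
  [/\ dotv ell (Utheta - Ustar) = dotv g r,
      sigma = Num.sqrt (dotv ellhat (invmx Hhat *m ellhat))
    & `|dotv ell (Utheta - Ustar)| <= sigma * wnorm W r].
Proof.
move=> Ustar Utheta r ellhat Hhat g sigma.
set Ahat := reduced_op A Z in Ahat_rank ystar_argmin q_sol Hhat g sigma *.
set e := ytheta - ystar.
have errE : Utheta - Ustar = Z *m e.
  by rewrite /Utheta /Ustar opprD addrACA subrr add0r mulmxBr.
have rE : r = (Ahat *m ystar - reduced_rhs A b U0) + Ahat *m e.
  rewrite /r /Utheta /reduced_rhs /e mulmxBr mulmxDr mulmxA -/Ahat opprB.
  by rewrite [RHS]addrC -!addrA addKr addrCA.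
have dotvgE x : dotv g x = dotv (Ahat *m q) (W *m x).
  by rewrite /g -mulmxA dotv_mulmxr W_spd.1.
have dual : dotv ell (Utheta - Ustar) = dotv g r.
  rewrite errE dotvgE rE mulmxDr dotvDr lsq_argmin_orthogonal// add0r.
  rewrite -dotv_gram dotv_mulmxr -q_sol dotvC dotv_mulmxr.
  by rewrite (sym_posdef_gram W_spd Ahat_rank).1 dotvC.
(* This turns the dual norm of [g] into the W-norm of [Ahat *m q], for both the formula for [sigma]
   and the bound. *)
have Wg : invmx W *m g = Ahat *m q.
  by rewrite /g -mulmxA mulKmx ?sym_posdef_unitmx.
have sigmaE : sigma = wnorm W (Ahat *m q).
  by rewrite /sigma /wnorm Wg dotvgE.
split=> //.
  (* Since [ellhat] is [Hhat *m q], both radicands equal the [Hhat]-form at [q]. *)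
  rewrite sigmaE /wnorm -dotv_gram /ellhat -q_sol mulKmx 1?dotvC//.
  exact/sym_posdef_unitmx/sym_posdef_gram.
by rewrite dual sigmaE dotvgE wnorm_cauchy_schwarz.
Qed.
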